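(* The following statements hold: (1) For every $f\in\mathbb{R}[x,y]$, $\mathbf{Symm}(f)\subset\mathbf{Symm}(\triangle f)$. (2) For all $f_1,f_2\in\mathbb{R}[x,y]$, $\mathbf{Sim}(f_1,f_2)\subset\mathbf{Sim}(\triangle f_1,\triangle f_2)$.
   Context: $\triangle f=\partial_x^2 f+\partial_y^2 f$ is the Laplacian. An isometry of the plane is a map $X\mapsto AX+b$ with $A$ a real orthogonal $2\times 2$ matrix and $b\in\mathbb{R}^2$. A similarity of the plane is a map $X\mapsto \mu AX+b$ with $\mu\in\mathbb{R}\setminus\{0\}$, $A$ a real orthogonal $2\times2$ matrix and $b\in\mathbb{R}^2$. For polynomials $f,f_1,f_2\in\mathbb{R}[x,y]$: $\mathbf{Symm}(f)$ is the set of isometries $\phi$ of the plane such that $f\circ\phi=\lambda f$ for some constant $\lambda\neq 0$; $\mathbf{Sim}(f_1,f_2)$ is the set of similarities $\phi$ of the plane such that $f_1\circ\phi=\lambda f_2$ for some constant $\lambda\neq0$. *)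

(* Defs.v *)
From HB Require Import structures.
From mathcomp Require Import all_boot all_order all_algebra.
From mathcomp Require Import classical_sets reals.
From mathcomp Require Import mpoly.

Set Implicit Arguments.
Unset Strict Implicit.
Unset Printing Implicit Defensive.

Import Order.TTheory GRing.Theory Num.Theory.

Local Open Scope classical_set_scope.
Local Open Scope ring_scope.

(* [{mpoly R[2]}] is R[x, y], with x = 'X_0 and y = 'X_1; the plane is
   [ 'cV[R]_2 ], so that X 0 0 and X 1 0 are the coordinates of X. *)

Definition polyfun (R : realType) (f : {mpoly R[2]}) : 'cV[R]_2 -> R :=
  fun X => f.@[fun i => X i 0].

Definition laplacian (R : realType) (f : {mpoly R[2]}) : {mpoly R[2]} :=
  (f^`M(0))^`M(0) + (f^`M(1))^`M(1).

Definition orthogonal_mx (R : realType) (A : 'M[R]_2) : Prop :=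
  A^T *m A = 1%:M.

Definition isometry (R : realType) (phi : 'cV[R]_2 -> 'cV[R]_2) : Prop :=
  exists (A : 'M[R]_2) (b : 'cV[R]_2),
    orthogonal_mx A /\ forall X, phi X = A *m X + b.

Definition similarity (R : realType) (phi : 'cV[R]_2 -> 'cV[R]_2) : Prop :=
  exists (mu : R) (A : 'M[R]_2) (b : 'cV[R]_2),
    [/\ mu != 0, orthogonal_mx A & forall X, phi X = (mu *: A) *m X + b].

Definition Symm (R : realType) (f : {mpoly R[2]}) :
    set ('cV[R]_2 -> 'cV[R]_2) :=
  [set phi | isometry phi /\
    exists2 lambda : R, lambda != 0 &
      forall X, (polyfun f \o phi) X = lambda * polyfun f X].

Definition Sim (R : realType) (f1 f2 : {mpoly R[2]}) :
    set ('cV[R]_2 -> 'cV[R]_2) :=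
  [set phi | similarity phi /\
    exists2 lambda : R, lambda != 0 &
      forall X, (polyfun f1 \o phi) X = lambda * polyfun f2 X].

(* Main.v *)
(* If f1 o phi = lambda f2 with phi of linear part mu A, the chain rule gives
   mu^2 (laplacian f1) o phi = lambda (laplacian f2), because A A^T = 1 kills
   the mixed second derivatives; isometries are the case mu = 1. The hypothesis
   is an identity of functions, not of polynomials, so it is differentiated by
   restricting to lines: a real polynomial in one variable that vanishes
   everywhere is zero. *)
Require Import Defs.
From HB Require Import structures.
From mathcomp Require Import all_boot all_order all_algebra.
From mathcomp Require Import classical_sets reals.
From mathcomp Require Import mpoly.

Import Order.TTheory GRing.Theory Num.Theory.

Local Open Scope classical_set_scope.
Local Open Scope ring_scope.

(** Reduces the chain rule and the restriction to lines to checks on generators and stability under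
    the ring operations. *)
Lemma mpoly_ring_ind [n : nat] [R : comNzRingType] (P : {mpoly R[n]} -> Prop) :
    (forall c, P c%:MP) -> (forall i, P 'X_i) ->
    (forall p q, P p -> P q -> P (p + q)) ->
    (forall p q, P p -> P q -> P (p * q)) ->
  forall p, P p.
Proof.
move=> PC PX PD PM p; rewrite [p]mpolyE.
apply: (big_ind P) => [||m _]; [by rewrite -mpolyC0 | exact: PD |].
rewrite -mul_mpolyC mpolyXE_id; apply: (PM) => //.
apply: (big_ind P) => [||i _]; [exact: (PC 1) | exact: PM |].
by elim: (m i) => [|k IHk]; [exact: (PC 1) | rewrite exprS; apply: PM].
Qed.

Lemma mderivXU {n : nat} {R : comNzRingType} (i j : 'I_n) :
  ('X_j : {mpoly R[n]})^`M(i) = (j == i)%:R.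
Proof.
rewrite mderivX mnm1E; case: eqP => [->|_]; last by rewrite scale0r.
by rewrite -{1}[U_(i)%MM]add0m addmK mpolyX0 scale1r.
Qed.

(** Chain rule: both sides are additive in [p], obey the same Leibniz rule, and agree on constants
    and variables. *)
Lemma mderiv_comp {n k : nat} {R : comNzRingType} (lq : n.-tuple {mpoly R[k]})
    (p : {mpoly R[n]}) (i : 'I_k) :
  (p \mPo lq)^`M(i) = \sum_j (p^`M(j) \mPo lq) * (tnth lq j)^`M(i).
Proof.
elim/mpoly_ring_ind: p => [c|j|p q IHp IHq|p q IHp IHq].
- rewrite comp_mpolyC mderivC big1 // => j _.
  by rewrite mderivC comp_mpoly0 mul0r.
- rewrite comp_mpolyXU -tnth_nth (bigD1 j) //= mderivXU eqxx comp_mpoly1 mul1r.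
  rewrite big1 ?addr0 // => l; rewrite eq_sym => /negbTE jl.
  by rewrite mderivXU jl comp_mpoly0 mul0r.
- rewrite comp_mpolyD mderivD IHp IHq -big_split; apply: eq_bigr => j _ /=.
  by rewrite mderivD comp_mpolyD mulrDl.
- rewrite rmorphM mderivM IHp IHq mulr_suml mulr_sumr -big_split.
  apply: eq_bigr => j _ /=.
  by rewrite mderivM comp_mpolyD !rmorphM mulrDl -!mulrA; congr (_ * _ + _);
     rewrite mulrC.
Qed.

Lemma horner_eq0_poly {R : numDomainType} (q : {poly R}) :
  (forall t, q.[t] = 0) -> q = 0.
Proof.
move=> q0; apply/eqP/negPn/negP => qN0.
(* The naturals below [size q] are distinct in a numeric domain, and they are one root more than the
   degree of [q] allows. *)
have := max_poly_roots (rs := [seq i%:R | i <- iota 0 (size q)]) qN0.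
rewrite size_map size_iota ltnn => H; apply/notF/H; last first.
  by rewrite map_inj_uniq ?iota_uniq //; apply: mulrIn; rewrite oner_eq0.
by apply/allP => x _; apply/rootP.
Qed.

(** Here [q] is the restriction of [p] to the line through [v] in direction [i]. The existential
    form lets the induction build [q] along with [p]. *)
Lemma mderiv_horner {n : nat} {R : comNzRingType} (p : {mpoly R[n]}) (i : 'I_n)
    (v : 'I_n -> R) :
  exists q : {poly R},
    (forall t, q.[t] = p.@[fun j => v j + t * (j == i)%:R]) /\
    q^`().[0] = (p^`M(i)).@[v].
Proof.
elim/mpoly_ring_ind: p =>
  [c|j|p r [q [qE dqE]] [s [sE dsE]]|p r [q [qE dqE]] [s [sE dsE]]].
- exists c%:P; split=> [t|]; first by rewrite hornerC mevalC.
  by rewrite derivC mderivC horner0 meval0.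
- exists ((v j)%:P + 'X * (j == i)%:R%:P); split=> [t|].
    by rewrite mevalXU !hornerE.
  rewrite derivD derivC add0r derivM derivX derivC mulr0 addr0 mul1r hornerC.
  by rewrite mderivXU rmorph_nat.
- exists (q + s); split=> [t|]; first by rewrite hornerD mevalD qE sE.
  by rewrite derivD hornerD mderivD mevalD dqE dsE.
(* The Leibniz rule at 0 also involves the values of [q] and [s] at 0, taken at the base point [v]
   of the line. *)
- have at0 (f : {mpoly R[n]}) : f.@[fun j => v j + 0 * (j == i)%:R] = f.@[v].
    by apply: meval_eq => j; rewrite mul0r addr0.
  exists (q * s); split=> [t|]; first by rewrite hornerM mevalM qE sE.
  by rewrite derivM hornerD !hornerM mderivM mevalD !mevalM dqE dsE qE sE !at0.
Qed.

(** Hypothesis and conclusion have the same shape, so the lemma can be iterated to reach second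
    derivatives. *)
Lemma meval_mderiv_eq0 {n : nat} {R : numDomainType} (p : {mpoly R[n]})
    (i : 'I_n) :
  (forall v, p.@[v] = 0) -> forall v, (p^`M(i)).@[v] = 0.
Proof.
move=> p0 v; have [q [qE <-]] := mderiv_horner p i v.
by rewrite (@horner_eq0_poly _ q) ?deriv0 ?horner0 // => t; rewrite qE.
Qed.

(** The affine map with linear part [M] and translation [b], given by polynomials so that
    composition with it can be differentiated formally. *)
Definition affine_tuple {n k : nat} {R : comNzRingType} (M : 'M[R]_(n, k))
    (b : 'cV[R]_n) : n.-tuple {mpoly R[k]} :=
  [tuple \sum_l M j l *: 'X_l + (b j 0)%:MP | j < n].

Lemma meval_affine_tuple {n k : nat} {R : comNzRingType} (M : 'M[R]_(n, k))
    (b : 'cV[R]_n) (p : {mpoly R[n]}) (X : 'cV[R]_k) :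
  (p \mPo affine_tuple M b).@[X^~ 0] = p.@[(M *m X + b)^~ 0].
Proof.
rewrite comp_mpoly_meval; apply: meval_eq => j.
rewrite tnth_mktuple mevalD mevalC !mxE raddf_sum /=; congr (_ + _).
by apply: eq_bigr => l _; rewrite mevalZ mevalXU.
Qed.

Lemma mderiv_affine_tuple {n k : nat} {R : comNzRingType} (M : 'M[R]_(n, k))
    (b : 'cV[R]_n) (i : 'I_k) (j : 'I_n) :
  (tnth (affine_tuple M b) j)^`M(i) = (M j i)%:MP.
Proof.
rewrite tnth_mktuple mderivD mderivC addr0 raddf_sum /= (bigD1 i) //=.
rewrite big1 => [|l li].
  by rewrite addr0 mderivZ mderivXU eqxx alg_mpolyC.
by rewrite mderivZ mderivXU (negbTE li) scaler0.
Qed.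

(** The Jacobian [M] is constant, so applying the chain rule twice leaves no first-order terms. *)
Lemma mderiv2_affine_comp {n k : nat} {R : comNzRingType} (M : 'M[R]_(n, k))
    (b : 'cV[R]_n) (p : {mpoly R[n]}) (i : 'I_k) :
  ((p \mPo affine_tuple M b)^`M(i))^`M(i) =
  \sum_j \sum_l (M j i * M l i) *: (p^`M(j)^`M(l) \mPo affine_tuple M b).
Proof.
rewrite mderiv_comp raddf_sum; apply: eq_bigr => j _ /=.
rewrite mderiv_affine_tuple mulrC mderiv_mulC mderiv_comp mulr_sumr.
apply: eq_bigr => l _.
by rewrite mderiv_affine_tuple [_ * (M l i)%:MP]mulrC mulrA -mpolyCM mul_mpolyC.
Qed.

Lemma laplacianE {R : realType} (f : {mpoly R[2]}) :
  laplacian f = \sum_i (f^`M(i))^`M(i).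
Proof.
rewrite /laplacian !big_ord_recl big_ord0 addr0.
by congr (f^`M(_)^`M(_) + f^`M(_)^`M(_)); apply: val_inj.
Qed.

Lemma laplacian_affine_comp {R : realType} (mu : R) (A : 'M[R]_2) (b : 'cV[R]_2)
    (f : {mpoly R[2]}) :
  orthogonal_mx A ->
  laplacian (f \mPo affine_tuple (mu *: A) b) =
  mu ^+ 2 *: (laplacian f \mPo affine_tuple (mu *: A) b).
Proof.
(* Orthogonality is given for the columns; the coefficients summed over [i] below pair rows, hence
   the passage to [A *m A^T]. *)
move=> /mulmx1C AAt.
have rows j l : \sum_i (mu *: A) j i * (mu *: A) l i = mu ^+ 2 * (j == l)%:R.
  move/matrixP/(_ j l): AAt; rewrite !mxE => <-; rewrite mulr_sumr.
  by apply: eq_bigr => i _; rewrite !mxE mulrACA.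
rewrite !laplacianE (raddf_sum (comp_mpoly _)) scaler_sumr.
under eq_bigr do rewrite mderiv2_affine_comp.
rewrite exchange_big; apply: eq_bigr => j _ /=.
(* Row orthogonality keeps only [l = j], with coefficient [mu ^+ 2]. *)
rewrite exchange_big (bigD1 j) //= [X in _ + X]big1 => [|l lj].
  by rewrite -scaler_suml rows eqxx mulr1 addr0.
by rewrite -scaler_suml rows eq_sym (negbTE lj) mulr0 scale0r.
Qed.

Lemma polyfun_laplacian_similarity {R : realType} (f1 f2 : {mpoly R[2]})
    (mu lambda : R) (A : 'M[R]_2) (b : 'cV[R]_2) :
  mu != 0 -> orthogonal_mx A ->
  (forall X, polyfun f1 ((mu *: A) *m X + b) = lambda * polyfun f2 X) ->
  forall X, polyfun (laplacian f1) ((mu *: A) *m X + b) =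
            lambda / mu ^+ 2 * polyfun (laplacian f2) X.
Proof.
move=> mu0 oA f12 X.
pose P := f1 \mPo affine_tuple (mu *: A) b - lambda *: f2.
have P0 v : P.@[v] = 0.
  (* The hypothesis speaks of column vectors, evaluation of arbitrary valuations. *)
  have vE : v =1 (\col_i v i)^~ 0 by move=> i; rewrite mxE.
  rewrite (meval_eq _ vE) mevalB mevalZ meval_affine_tuple.
  by apply/eqP; rewrite subr_eq0; apply/eqP/f12.
have /eqP : (laplacian P).@[X^~ 0] = 0.
  by rewrite mevalD !(meval_mderiv_eq0 _ _ (meval_mderiv_eq0 _ _ P0)) addr0.
have -> : laplacian P = mu ^+ 2 *: (laplacian f1 \mPo affine_tuple (mu *: A) b)
                        - lambda *: laplacian f2.
  rewrite -laplacian_affine_comp // !laplacianE scaler_sumr -sumrB.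
  by apply: eq_bigr => i _; rewrite !mderivB !mderivZ.
rewrite mevalB !mevalZ meval_affine_tuple subr_eq0 => /eqP lapE.
have mu2 : mu ^+ 2 != 0 by rewrite expf_neq0.
by apply: (mulfI mu2); rewrite mulrA mulrCA divff // mulr1; apply: lapE.
Qed.

Theorem theorem8 (R : realType) :
  (forall f : {mpoly R[2]}, Symm f `<=` Symm (laplacian f)) /\
  (forall f1 f2 : {mpoly R[2]},
     Sim f1 f2 `<=` Sim (laplacian f1) (laplacian f2)).
Proof.
split=> [f|f1 f2] phi.
  move=> [[A [b [oA phiE]]] [lambda l0 fphi]]; split; first by exists A, b.
  exists lambda => // X.
  (* With [mu = 1] the factor [lambda / mu ^+ 2] is [lambda] itself. *)
  have := @polyfun_laplacian_similarity R f f 1 lambda A b (oner_neq0 _) oA.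
  rewrite scale1r expr1n divr1 /= phiE; apply=> Y.
  by rewrite -phiE; apply: fphi.
move=> [[mu [A [b [mu0 oA phiE]]]] [lambda l0 fphi]]; split.
  by exists mu, A, b.
exists (lambda / mu ^+ 2); first by rewrite mulf_neq0 ?invr_neq0 ?expf_neq0.
move=> X /=; rewrite phiE; apply: polyfun_laplacian_similarity => // Y.
by rewrite -phiE; apply: fphi.
Qed.
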